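(* For every $n\in\mathbb{Z}_{\geq 0}$ the following two identities hold, in $\mathbb{Q}[[x,y]]$: \[ \sum_{l=0}^{\infty}\sum_{m=0}^{\infty}\mathscr{B}_{m}^{(-l)}(n)\frac{x^{l}}{l!}\frac{y^{m}}{m!} = \frac{n!\,e^{x+y}}{(e^{x}+e^{y}-e^{x+y})^{n+1}} \] and \[ \sum_{l=0}^{\infty}\sum_{m=0}^{\infty}\mathscr{B}_{m}^{(-l)}(n)\,x^{l}y^{m} = \sum_{j=0}^{\infty} j!\,(j+n)!\,Q_{j}(x)Q_{j}(y), \] where $Q_{j}(X) = \dfrac{X^{j}}{(1-X)(1-2X)\cdots(1-(j+1)X)}$ for $j\in\mathbb{Z}_{\geq 0}$, expanded as a power series in $X$.
   Context: For $k\in\mathbb{Z}$ let $\mathrm{Li}_k(z)=\sum_{m\ge1} z^m/m^k$ (for $k\le 0$ this is a rational function of $z$). The poly-Bernoulli polynomials $B_n^{(k)}(x)$ ($k\in\mathbb{Z}$, $n\ge0$) are defined by $e^{-xt}\frac{\mathrm{Li}_k(1-e^{-t})}{1-e^{-t}}=\sum_{n\ge0}B_n^{(k)}(x)\frac{t^n}{n!}$. The Stirling numbers of the first kind ${n \brack j}$ are defined by ${0\brack 0}=1$, ${n\brack 0}={0\brack m}=0$ for $m,n\neq0$, and ${n+1\brack m}={n\brack m-1}+n{n\brack m}$ for $n\ge0,m\ge1$. For $l,m,n\in\mathbb{Z}_{\ge0}$ set $\mathscr{B}_{m}^{(-l)}(n)=\sum_{j=0}^{n}{n\brack j}B_m^{(-l-j)}(n)$.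 *)

(* Defs.v *)
From HB Require Import structures.
From mathcomp Require Import all_boot all_order all_algebra.
From mathcomp Require Import boolp.

Set Implicit Arguments.
Unset Strict Implicit.
Unset Printing Implicit Defensive.

Import GRing.Theory.

Local Open Scope ring_scope.

(* Formal power series.  {fps R} is R[[X]]; f n is the coefficient of X^n.    *)

Record fps (R : Type) := Fps { fps_coef : nat -> R }.
Add Printing Constructor fps.
Coercion fps_coef : fps >-> Funclass.

Notation "{ 'fps' R }" := (fps R) (format "{ 'fps'  R }") : type_scope.

Lemma fpsP (R : Type) (f g : {fps R}) : (forall n, f n = g n) <-> f = g.
Proof.
split=> [|-> //]; case: f g => [f] [g] /= fg.
by congr Fps; apply: funext.
Qed.

HB.instance Definition _ (R : Type) := gen_eqMixin {fps R}.
HB.instance Definition _ (R : Type) := gen_choiceMixin {fps R}.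

Section Ring.
Variable R : comNzRingType.
Implicit Types f g h : {fps R}.

Definition fps_zero : {fps R} := Fps (fun=> 0).
Definition fps_opp f : {fps R} := Fps (fun n => - f n).
Definition fps_add f g : {fps R} := Fps (fun n => f n + g n).
Definition fps_one : {fps R} := Fps (fun n => (n == 0%N)%:R).
Definition fps_mul f g : {fps R} :=
  Fps (fun n => \sum_(i < n.+1) f i * g (n - i)%N).

Fact fps_addA : associative fps_add.
Proof. by move=> f g h; apply/fpsP => n /=; rewrite addrA. Qed.
Fact fps_addC : commutative fps_add.
Proof. by move=> f g; apply/fpsP => n /=; rewrite addrC. Qed.
Fact fps_add0 : left_id fps_zero fps_add.
Proof. by move=> f; apply/fpsP => n /=; rewrite add0r. Qed.
Fact fps_addN : left_inverse fps_zero fps_opp fps_add.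
Proof. by move=> f; apply/fpsP => n /=; rewrite addNr. Qed.

HB.instance Definition _ := GRing.isZmodule.Build {fps R}
  fps_addA fps_addC fps_add0 fps_addN.

Let trunc N f : {poly R} := \poly_(i < N.+1) f i.

Let coef_truncM N (p q : {poly R}) f g n : (n <= N)%N ->
  (forall i, (i <= N)%N -> p`_i = f i) -> (forall i, (i <= N)%N -> q`_i = g i) ->
  (p * q)`_n = fps_mul f g n.
Proof.
move=> le_nN pf qg; rewrite coefM /=; apply: eq_bigr => i _.
rewrite pf ?qg //; first exact: leq_trans (leq_subr _ _) le_nN.
by apply: leq_trans le_nN; rewrite -ltnS.
Qed.

Let coef_trunc N f i : (i <= N)%N -> (trunc N f)`_i = f i.
Proof. by move=> le_iN; rewrite coef_poly ltnS le_iN. Qed.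

Fact fps_mulA : associative fps_mul.
Proof.
move=> f g h; apply/fpsP => n.
have T (k : {fps R}) i := @coef_trunc n k i.
have M (k k' : {fps R}) i (le_in : (i <= n)%N) :=
  @coef_truncM n _ _ k k' i le_in (T k) (T k').
by rewrite -(coef_truncM (leqnn n) (T f) (M g h)) mulrA
           (coef_truncM (leqnn n) (M f g) (T h)).
Qed.
Fact fps_mulC : commutative fps_mul.
Proof.
move=> f g; apply/fpsP => n.
have T (k : {fps R}) i := @coef_trunc n k i.
by rewrite -(coef_truncM (leqnn n) (T f) (T g)) mulrC
           (coef_truncM (leqnn n) (T g) (T f)).
Qed.
Fact fps_mul1 : left_id fps_one fps_mul.
Proof.
move=> f; apply/fpsP => n /=.
rewrite big_ord_recl /= mul1r subn0 big1 ?addr0 // => i _.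
by rewrite mul0r.
Qed.
Fact fps_mulDl : left_distributive fps_mul fps_add.
Proof.
move=> f g h; apply/fpsP => n /=; rewrite -big_split /=.
by apply: eq_bigr => i _; rewrite mulrDl.
Qed.
Fact fps_one_neq0 : fps_one != 0.
Proof.
apply/eqP => /(congr1 (fun f : {fps R} => f 0%N)) /= /eqP.
by rewrite oner_eq0.
Qed.

HB.instance Definition _ := GRing.Zmodule_isComNzRing.Build {fps R}
  fps_mulA fps_mulC fps_mul1 fps_mulDl fps_one_neq0.

Lemma fps_coef0 n : (0 : {fps R}) n = 0. Proof. by []. Qed.
Lemma fps_coefN f n : (- f) n = - f n. Proof. by []. Qed.
Lemma fps_coefD f g n : (f + g) n = f n + g n. Proof. by []. Qed.
Lemma fps_coefB f g n : (f - g) n = f n - g n. Proof. by []. Qed.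
Lemma fps_coef1 n : (1 : {fps R}) n = (n == 0%N)%:R. Proof. by []. Qed.
Lemma fps_coefM f g n : (f * g) n = \sum_(i < n.+1) f i * g (n - i)%N.
Proof. by []. Qed.
Lemma fps_coef_sum (I : Type) (r : seq I) (P : pred I) (F : I -> {fps R}) n :
  (\sum_(i <- r | P i) F i) n = \sum_(i <- r | P i) F i n.
Proof. by elim/big_rec2: _ => // i y1 y2 _ <-. Qed.

Lemma fps_coef0M f g : (f * g) 0%N = f 0%N * g 0%N.
Proof. by rewrite fps_coefM big_ord1 subnn. Qed.

Lemma fps_coefX_gt f k n : f 0%N = 0 -> (n < k)%N -> (f ^+ k) n = 0.
Proof.
move=> f0; elim: k n => // k IHk n lt_nk.
rewrite exprS fps_coefM big1 // => -[[|i] /= lt_in] _; first by rewrite f0 mul0r.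
rewrite IHk ?mulr0 //; case: n lt_nk lt_in => // n lt_nk lt_in.
by rewrite subSS (leq_ltn_trans (leq_subr _ _)).
Qed.

Definition fpsC (a : R) : {fps R} := Fps (fun n => if n is 0%N then a else 0).
Definition fpsX : {fps R} := Fps (fun n => (n == 1%N)%:R).

Lemma fps_coefCM a f n : (fpsC a * f) n = a * f n.
Proof.
rewrite fps_coefM big_ord_recl subn0 big1 ?addr0 // => i _.
by rewrite mul0r.
Qed.

(* (f - f 0) / X *)
Definition fps_shift f : {fps R} := Fps (fun n => f n.+1).

Lemma fps_shiftE f : fpsX * fps_shift f = f - fpsC (f 0%N).
Proof.
apply/fpsP => -[|n]; first by rewrite fps_coef0M mul0r fps_coefB subrr.
rewrite fps_coefM !big_ord_recl !mul0r add0r mul1r /= subSS subn0.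
by rewrite big1 ?addr0 ?subr0 // => i _; rewrite mul0r.
Qed.

(* The substitution f(g), meaningful when g 0 = 0: then (g ^+ i) n = 0 for    *)
(* i > n, so that the sum of the f i * (g ^+ i) n over all i is finite.       *)
Definition fps_comp f g : {fps R} :=
  Fps (fun n => \sum_(i < n.+1) f i * (g ^+ i) n).

Lemma fps_coef_comp f g n :
  fps_comp f g n = \sum_(i < n.+1) f i * (g ^+ i) n.
Proof. by []. Qed.

Lemma fps_comp_coef0 f g : fps_comp f g 0%N = f 0%N.
Proof. by rewrite fps_coef_comp big_ord1 expr0 fps_coef1 mulr1. Qed.

Lemma fps_comp_coef1 f g : fps_comp f g 1%N = f 1%N * g 1%N.
Proof.
rewrite fps_coef_comp !big_ord_recl big_ord0 expr0 expr1 fps_coef1.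
by rewrite mulr0 add0r addr0.
Qed.

End Ring.

Section UnitRing.
Variable R : comUnitRingType.
Implicit Types f g : {fps R}.

Definition fps_unit : {pred {fps R}} := [pred f : {fps R} | f 0%N \is a GRing.unit].

(* For a unit a = f 0, f^-1 = a^-1 (1 + u + u^2 + ...) with u = 1 - a^-1 f.   *)
Definition fps_inv f : {fps R} :=
  if f \in fps_unit then
    Fps (fun n =>
      \sum_(k < n.+1) (f 0%N)^-1 * ((1 - fpsC (f 0%N)^-1 * f) ^+ k) n)
  else f.

Fact fps_mulV : {in fps_unit, left_inverse 1 fps_inv *%R}.
Proof.
move=> f fU; rewrite /fps_inv fU; set a := (f 0%N)^-1; set u := 1 - _.
have u0 : u 0%N = 0.
  by rewrite fps_coefB fps_coefCM mulVr // fps_coef1 subrr.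
have fE : fpsC a * f = 1 - u by rewrite /u opprB addrC subrK.
apply/fpsP => n; transitivity ((fpsC a * (\sum_(k < n.+1) u ^+ k) * f) n).
  rewrite [LHS]fps_coefM [RHS]fps_coefM; apply: eq_bigr => i _; congr (_ * _).
  rewrite fps_coefCM fps_coef_sum mulr_sumr [LHS]/fps_coef.
  rewrite (big_ord_widen _ (fun k => a * (u ^+ k) i) (ltn_ord i)).
  rewrite big_mkcond; apply: eq_bigr => k _; case: ifPn => //.
  by rewrite -leqNgt => lt_ik; rewrite fps_coefX_gt ?mulr0.
rewrite mulrAC fE -opprB mulNr -subrX1 opprB fps_coefB fps_coefX_gt //.
by rewrite subr0.
Qed.
Fact fps_unitPl f g : g * f = 1 -> fps_unit f.
Proof.
move=> /(congr1 (fun h : {fps R} => h 0%N)); rewrite fps_coef0M => gf.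
by apply/unitrPr; exists (g 0%N); rewrite mulrC.
Qed.
Fact fps_inv_out : {in [predC fps_unit], fps_inv =1 id}.
Proof. by move=> f; rewrite inE /= /fps_inv => /negPf ->. Qed.

HB.instance Definition _ := GRing.ComNzRing_hasMulInverse.Build {fps R}
  fps_mulV fps_unitPl fps_inv_out.

Lemma fps_unitE f : (f \is a GRing.unit) = (f 0%N \is a GRing.unit).
Proof. by []. Qed.

(* The quotient f / g of two series of the form f = X f', g = X g' with g' a  *)
(* unit; here g itself is not a unit of R[[X]].                               *)
Definition fps_quo f g : {fps R} := fps_shift f / fps_shift g.

Lemma fps_quoP f g : f 0%N = 0 -> g 0%N = 0 -> g 1%N \is a GRing.unit ->
  g * fps_quo f g = f.
Proof.
move=> f0 g0 gU.
have shE (h : {fps R}) : h 0%N = 0 -> h = fpsX R * fps_shift h.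
  move=> h0; rewrite fps_shiftE h0.
  by apply/fpsP => -[|n]; rewrite fps_coefB subr0.
rewrite [X in X * _](shE g g0) [RHS](shE f f0) /fps_quo -mulrA.
by rewrite (mulrC (fps_shift g)) divrK // fps_unitE.
Qed.

(* e^g, for g 0 = 0 *)
Definition fps_exp (g : {fps R}) : {fps R} :=
  fps_comp (Fps (fun i => (i`!%:R)^-1)) g.

End UnitRing.

(* Bivariate series.  R[[x,y]] is represented as {fps {fps R}} = R[[y]][[x]]; *)
(* for f in this ring, f l m is the coefficient of x^l y^m.                   *)

Section Bivariate.
Variable R : comUnitRingType.

Definition varx : {fps {fps R}} := fpsX {fps R}.
Definition vary : {fps {fps R}} := fpsC (fpsX R).

(* e^g for g without constant term (g 0 0 = 0): then (g ^+ i) l m = 0 as soon *)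
(* as i > l + m.                                                              *)
Definition fps2_exp (g : {fps {fps R}}) : {fps {fps R}} :=
  Fps (fun l => Fps (fun m =>
    \sum_(i < (l + m).+1) (i`!%:R)^-1 * (g ^+ i) l m)).

(* Convergence of the formal series \sum_j F j to S: every coefficient of the *)
(* partial sums is eventually equal to that of S.                             *)
Definition fps2_is_sum (F : nat -> {fps {fps R}}) (S : {fps {fps R}}) : Prop :=
  forall l m, exists N, forall M, (N <= M)%N ->
    (\sum_(j < M) F j) l m = S l m.

End Bivariate.
Arguments varx {R}.
Arguments vary {R}.

(* Li_k(z) = \sum_(m >= 1) z^m / m^k, over a ring R containing the rationals. *)
Definition polylog (R : comUnitRingType) (k : int) : {fps R} :=
  Fps (fun m => if m is 0%N then 0 else m%:R ^ (- k)).

(* 1 - e^(-t) in Q[x][[t]] *)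
Definition one_sub_expN : {fps {poly rat}} := 1 - fps_exp (- fpsX {poly rat}).

(* e^(-xt) Li_k(1 - e^(-t)) / (1 - e^(-t)) in Q[x][[t]] *)
Definition polyBernoulli_gf (k : int) : {fps {poly rat}} :=
  fps_exp (- (fpsC 'X * fpsX {poly rat})) *
  fps_quo (fps_comp (polylog {poly rat} k) one_sub_expN) one_sub_expN.

Definition polyBernoulli (n : nat) (k : int) : {poly rat} :=
  n`!%:R * polyBernoulli_gf k n.

Lemma polyBernoulli_gfP k :
  one_sub_expN * polyBernoulli_gf k =
  fps_exp (- (fpsC 'X * fpsX {poly rat})) *
  fps_comp (polylog {poly rat} k) one_sub_expN.
Proof.
have u0 : one_sub_expN 0%N = 0.
  by rewrite fps_coefB fps_comp_coef0 /= fact0 invr1 subrr.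
have u1 : one_sub_expN 1%N = 1.
  rewrite fps_coefB fps_comp_coef1 fps_coefN fps_coef1 sub0r mulrN opprK.
  by rewrite [LHS]/= invr1 mulr1.
by rewrite /polyBernoulli_gf mulrCA fps_quoP ?fps_comp_coef0 ?u1 ?unitr1.
Qed.

(* Unsigned Stirling numbers of the first kind *)
Fixpoint stirling1 (n m : nat) : nat :=
  match n, m with
  | 0, 0 => 1
  | 0, _.+1 => 0
  | _.+1, 0 => 0
  | n'.+1, m'.+1 => stirling1 n' m' + n' * stirling1 n' m'.+1
  end%N.

(* \mathscr{B}_m^{(-l)}(n) *)
Definition scrB (m l n : nat) : rat :=
  \sum_(j < n.+1)
    (stirling1 n j)%:R * (polyBernoulli m (- l%:Z - j%:Z)).[n%:R].

(* Q_j(X), for X a variable of a power series ring A *)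
Definition Qfrac (A : comUnitRingType) (j : nat) (X : A) : A :=
  X ^+ j / \prod_(1 <= i < j.+2) (1 - i%:R * X).

(* Main.v *)
(** Since [Li_{-k}(z) / z] is the sum of the [(p+1)^k z^p] and the Stirling
    numbers of the first kind expand rising factorials, the exponential
    generating function of [scrB m l n] is the sum over [p] of
    [(p+n)!/p! * e^{(p+1)x} e^{-ny} (1-e^{-y})^p], a negative binomial series
    in [e^x (1 - e^{-y})] that sums to the closed form.  As
    [e^x + e^y - e^{x+y} = 1 - (e^x-1)(e^y-1)], expanding the closed form again,
    now in powers of [(e^x-1)(e^y-1)], gives the second identity after undoing
    the division by [l! m!], because both [l!/j! [X^l] e^X (e^X-1)^j] and
    [[X^l] Q_j(X)] are the Stirling number of the second kind [S(l+1, j+1)]. *)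
Require Import Defs.
From HB Require Import structures.
From mathcomp Require Import all_boot all_order all_algebra.
From mathcomp Require Import ring zify.

Set Implicit Arguments.
Unset Strict Implicit.
Unset Printing Implicit Defensive.

Import GRing.Theory.
Local Open Scope ring_scope.

Section FpsRing.
Variable R : comNzRingType.
Implicit Types (f g h : {fps R}) (a b : R).

Lemma fps_coefMn f k n : (f *+ k) n = f n *+ k.
Proof. by elim: k => [|k IHk] //; rewrite !mulrS fps_coefD IHk. Qed.

Lemma fps_coefXM f n : (fpsX R * f) n.+1 = f n.
Proof.
rewrite fps_coefM !big_ord_recl /= mul0r add0r mul1r subSS subn0.
by rewrite big1 ?addr0 // => i _; rewrite mul0r.
Qed.

Lemma fps_coefXn k n : (fpsX R ^+ k) n = (k == n)%:R.
Proof.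
elim: k n => [|k IHk] [|n]; rewrite ?expr0 // exprS.
  by rewrite fps_coef0M mul0r.
by rewrite fps_coefXM IHk eqSS.
Qed.

Lemma fpsX_lreg : GRing.lreg (fpsX R).
Proof.
by move=> f g fg; apply/fpsP => n; rewrite -[LHS]fps_coefXM fg fps_coefXM.
Qed.

Fact fpsC_is_zmod_morphism : zmod_morphism (@fpsC R).
Proof. by move=> a b; apply/fpsP => -[|n] //=; rewrite subr0. Qed.
Fact fpsC_is_monoid_morphism : monoid_morphism (@fpsC R).
Proof.
split=> [|a b]; first by apply/fpsP => -[|n].
by apply/fpsP => -[|n]; rewrite fps_coefCM //= mulr0.
Qed.
HB.instance Definition _ :=
  GRing.isZmodMorphism.Build R {fps R} (@fpsC R) fpsC_is_zmod_morphism.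
HB.instance Definition _ :=
  GRing.isMonoidMorphism.Build R {fps R} (@fpsC R) fpsC_is_monoid_morphism.

Lemma fps_coefXn_linear a k n :
  ((fpsC a * fpsX R) ^+ k) n = a ^+ k *+ (k == n).
Proof. by rewrite exprMn -rmorphXn fps_coefCM fps_coefXn mulr_natr. Qed.

Lemma fps_coefXn_affine a b k n :
  ((fpsC a + fpsC b * fpsX R) ^+ k) n = a ^+ (k - n) * b ^+ n *+ 'C(k, n).
Proof.
rewrite exprDn fps_coef_sum.
under eq_bigr => i _.
  rewrite fps_coefMn -rmorphXn fps_coefCM fps_coefXn_linear mulrnAr mulrnAC.
  rewrite mulrb; over.
rewrite -big_mkcond.
rewrite (big_ord1_eq _ (fun i => a ^+ (k - i) * b ^+ i *+ 'C(k, i))) ltnS.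
by case: leqP => // lt_kn; rewrite bin_small.
Qed.

Lemma fps_compCM a f g : fps_comp (fpsC a * f) g = fpsC a * fps_comp f g.
Proof.
apply/fpsP => n; rewrite fps_coefCM !fps_coef_comp mulr_sumr.
by apply: eq_bigr => i _; rewrite fps_coefCM mulrA.
Qed.

Lemma fps_comp_suml (I : Type) (r : seq I) (P : pred I) (F : I -> {fps R}) g :
  fps_comp (\sum_(i <- r | P i) F i) g = \sum_(i <- r | P i) fps_comp (F i) g.
Proof.
apply/fpsP => n; rewrite fps_coef_sum fps_coef_comp.
under eq_bigr => k _ do rewrite fps_coef_sum mulr_suml.
exact: exchange_big.
Qed.

Lemma fps_coefM_comp f g h n N : g 0%N = 0 -> (n < N)%N ->
  (h * fps_comp f g) n = \sum_(i < N) f i * (h * g ^+ i) n.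
Proof.
move=> g0 lt_nN; rewrite fps_coefM.
under [RHS]eq_bigr => i _ do rewrite fps_coefM mulr_sumr.
rewrite exchange_big; apply: eq_bigr => k _ /=.
rewrite (big_ord_widen N (fun i => f i * (g ^+ i) (n - k)%N)); last by lia.
rewrite big_mkcond mulr_sumr; apply: eq_bigr => i _; rewrite mulrCA.
by case: ltnP => // lt_nki; rewrite fps_coefX_gt ?mulr0.
Qed.

Lemma fps_comp_shift f g : g 0%N = 0 ->
  g * fps_comp (fps_shift f) g = fps_comp f g - fpsC (f 0%N).
Proof.
move=> g0; apply/fpsP => n.
rewrite (fps_coefM_comp _ _ g0 (ltnSn n)) fps_coefB -[fps_comp f g]mul1r.
rewrite (@fps_coefM_comp _ _ _ _ n.+2) // [in RHS]big_ord_recl.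
rewrite expr0 -[f ord0 * _]fps_coefCM !mulr1.
by rewrite addrAC subrr add0r; apply: eq_bigr => i _; rewrite mul1r -exprS.
Qed.

Definition fps_deriv f : {fps R} := Fps (fun n => f n.+1 *+ n.+1).

Lemma fps_coef_deriv f n : fps_deriv f n = f n.+1 *+ n.+1.
Proof. by []. Qed.

Lemma fps_coefS_deriv f n : f n.+1 * n.+1`!%:R = fps_deriv f n * n`!%:R.
Proof. by rewrite fps_coef_deriv mulrnAl -mulrnAr -mulrnA mulnC -factS. Qed.

Lemma fps_derivB f g : fps_deriv (f - g) = fps_deriv f - fps_deriv g.
Proof. by apply/fpsP => n; rewrite fps_coefB /= mulrnBl. Qed.

Lemma fps_derivC a : fps_deriv (fpsC a) = 0.
Proof. by apply/fpsP => n; rewrite /= mul0rn. Qed.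

Lemma fps_derivM f g :
  fps_deriv (f * g) = fps_deriv f * g + f * fps_deriv g.
Proof.
apply/fpsP => n; rewrite fps_coefD /= -sumrMnl.
transitivity (\sum_(i < n.+2) (f i *+ i * g (n.+1 - i)%N)
  + \sum_(i < n.+2) (f i * g (n.+1 - i)%N *+ (n.+1 - i))).
  rewrite -big_split; apply: eq_bigr => i _ /=.
  by rewrite mulrnAl -mulrnDr subnKC // -ltnS.
congr (_ + _).
  by rewrite big_ord_recl mulr0n mul0r add0r; apply: eq_bigr.
rewrite big_ord_recr /= subnn mulr0n addr0; apply: eq_bigr => i _.
by rewrite mulrnAr subSn // -ltnS.
Qed.

Lemma fps_derivXn f k : fps_deriv (f ^+ k) = fps_deriv f * f ^+ k.-1 *+ k.
Proof.
case: k => [|k]; first by rewrite expr0 -(rmorph1 (@fpsC R)) fps_derivC.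
elim: k => [|k IHk]; first by rewrite expr0 mulr1.
by rewrite exprS fps_derivM IHk [f * _]mulrnAr [f * _]mulrCA -exprS -mulrS.
Qed.

End FpsRing.

Section FpsMap.
Variables (R S : comNzRingType) (phi : {rmorphism R -> S}).

Definition fps_map (f : {fps R}) : {fps S} := Fps (fun n => phi (f n)).

Lemma fps_coef_map f n : fps_map f n = phi (f n). Proof. by []. Qed.

Fact fps_map_is_zmod_morphism : zmod_morphism fps_map.
Proof. by move=> f g; apply/fpsP => n /=; rewrite rmorphB. Qed.
Fact fps_map_is_monoid_morphism : monoid_morphism fps_map.
Proof.
split=> [|f g]; apply/fpsP => n /=; first by rewrite rmorph_nat.
by rewrite rmorph_sum; apply: eq_bigr => i _; rewrite rmorphM.
Qed.
HB.instance Definition _ :=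
  GRing.isZmodMorphism.Build {fps R} {fps S} fps_map fps_map_is_zmod_morphism.
HB.instance Definition _ :=
  GRing.isMonoidMorphism.Build {fps R} {fps S} fps_map
    fps_map_is_monoid_morphism.

Lemma fps_map_comp f g :
  fps_map (fps_comp f g) = fps_comp (fps_map f) (fps_map g).
Proof.
apply/fpsP => n; rewrite fps_coef_comp /= rmorph_sum; apply: eq_bigr => i _.
by rewrite rmorphM -rmorphXn.
Qed.

End FpsMap.

Section FpsUnitRing.
Variable R : comUnitRingType.
Implicit Types f g : {fps R}.

Lemma fps_coef0V f : f \is a GRing.unit -> f^-1 0%N = (f 0%N)^-1.
Proof.
move=> fU; have f0U : f 0%N \is a GRing.unit by rewrite -fps_unitE.
by apply: (mulrI f0U); rewrite -fps_coef0M !divrr.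
Qed.

Lemma fps_oneB_unit f : f 0%N = 0 -> 1 - f \is a GRing.unit.
Proof. by move=> f0; rewrite fps_unitE fps_coefB f0 subr0 unitr1. Qed.

Lemma fps_lreg g : g 0%N = 0 -> g 1%N \is a GRing.unit -> GRing.lreg g.
Proof.
move=> g0 g1U; have -> : g = fpsX R * fps_shift g.
  by rewrite fps_shiftE g0 rmorph0 subr0.
by apply: lregM (@fpsX_lreg R) _; apply: mulrI; rewrite fps_unitE.
Qed.

Lemma fps_quo_comp f g : f 0%N = 0 -> g 0%N = 0 -> g 1%N \is a GRing.unit ->
  fps_quo (fps_comp f g) g = fps_comp (fps_shift f) g.
Proof.
move=> f0 g0 g1U; apply: (fps_lreg g0 g1U).
by rewrite fps_quoP ?fps_comp_coef0 // fps_comp_shift // f0 rmorph0 subr0.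
Qed.

End FpsUnitRing.

Definition fact_units (R : unitRingType) : Prop :=
  forall i, i`!%:R \is a @GRing.unit R.

Lemma fact_units_numField (R : numFieldType) : fact_units R.
Proof. by move=> i; rewrite unitfE Num.Theory.pnatr_eq0 -lt0n fact_gt0. Qed.

Lemma fact_units_rmorph (R S : unitRingType) :
  {rmorphism R -> S} -> fact_units R -> fact_units S.
Proof. by move=> phi factU i; rewrite -(rmorph_nat phi) rmorph_unit. Qed.

Lemma invr_fact_bin (R : comUnitRingType) n i : fact_units R -> (i <= n)%N ->
  n`!%:R^-1 *+ 'C(n, i) = i`!%:R^-1 * (n - i)`!%:R^-1 :> R.
Proof.
move=> factU le_in; apply: (mulrI (factU n)).
rewrite -[_^-1 *+ _]mulr_natr mulVKr // -(bin_fact le_in) 2!natrM.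
by rewrite -mulrA mulrACA !divrr // !mulr1.
Qed.

Section Borel.
Variable R : comUnitRingType.
Implicit Type f : {fps R}.

Definition fps_borel f : {fps R} := Fps (fun n => f n / n`!%:R).

Lemma fps_coef_borel f n : fps_borel f n = f n / n`!%:R.
Proof. by []. Qed.

Lemma fps_deriv_borel f : fact_units R ->
  fps_deriv (fps_borel f) = fps_borel (fps_shift f).
Proof.
move=> factU; apply/fpsP => n; rewrite fps_coef_deriv !fps_coef_borel -mulrnAr.
congr (_ * _); have := invr_fact_bin factU (leqnSn n).
by rewrite binSn subSnn invr1 mulr1.
Qed.

End Borel.

Section ExpCX.
Variable R : comUnitRingType.
Implicit Types a b : R.

Definition fps_expCX a : {fps R} := fps_exp (fpsC a * fpsX R).

Lemma fps_coef_expCX a n : fps_expCX a n = a ^+ n / n`!%:R.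
Proof.
rewrite fps_coef_comp big_ord_recr /= big1 => [|i _].
  by rewrite fps_coefXn_linear eqxx add0r mulrC.
by rewrite fps_coefXn_linear ltn_eqF ?mulr0.
Qed.

Lemma fps_expCX_coef0 a : fps_expCX a 0%N = 1.
Proof. by rewrite fps_coef_expCX invr1 mulr1. Qed.

Lemma fps_expCX_unit a : fps_expCX a \is a GRing.unit.
Proof. by rewrite fps_unitE fps_expCX_coef0 unitr1. Qed.

Lemma fps_expCX0 : fps_expCX 0 = 1.
Proof.
apply/fpsP => -[|n]; first exact: fps_expCX_coef0.
by rewrite fps_coef_expCX expr0n mul0r.
Qed.

Hypothesis factU : fact_units R.

Lemma fps_expCXD a b : fps_expCX (a + b) = fps_expCX a * fps_expCX b.
Proof.
rewrite [RHS]mulrC; apply/fpsP => n; rewrite fps_coefM fps_coef_expCX.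
rewrite exprDn mulr_suml; apply: eq_bigr => i _; rewrite !fps_coef_expCX.
rewrite mulrnAl -mulrnAr invr_fact_bin -1?ltnS //.
by rewrite [RHS]mulrACA [X in _ = X * _]mulrC.
Qed.

Lemma fps_expCXN a : fps_expCX (- a) = (fps_expCX a)^-1.
Proof.
apply: (mulrI (fps_expCX_unit a)).
by rewrite -fps_expCXD subrr fps_expCX0 divrr ?fps_expCX_unit.
Qed.

Lemma fps_expCXMn a k : fps_expCX (a *+ k) = fps_expCX a ^+ k.
Proof.
by elim: k => [|k IHk]; rewrite ?fps_expCX0 // mulrS exprS fps_expCXD IHk.
Qed.

Lemma fps_deriv_expCX a : fps_deriv (fps_expCX a) = fpsC a * fps_expCX a.
Proof.
have -> : fps_expCX a = fps_borel (Fps (fun n => a ^+ n)).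
  by apply/fpsP => n; rewrite fps_coef_expCX.
rewrite fps_deriv_borel //; apply/fpsP => n.
by rewrite fps_coefCM !fps_coef_borel /= exprS mulrA.
Qed.

End ExpCX.

Lemma fps_map_expCX (R S : comUnitRingType) (phi : {rmorphism R -> S}) (a : R) :
  fact_units R -> fps_map phi (fps_expCX a) = fps_expCX (phi a).
Proof.
move=> factU; apply/fpsP => n; rewrite fps_coef_map !fps_coef_expCX.
by rewrite rmorph_div // rmorphXn rmorph_nat.
Qed.

Lemma stirling1_gt n m : (n < m)%N -> stirling1 n m = 0%N.
Proof.
elim: n m => [|n IHn] [|m] //= lt_nm.
by rewrite !IHn ?muln0 // (ltn_trans (ltnSn n)).
Qed.

Lemma sum_stirling1_rising (R : comPzSemiRingType) n (a : R) :
  \sum_(j < n.+1) (stirling1 n j)%:R * a ^+ j = \prod_(i < n) (a + i%:R).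
Proof.
elim: n => [|n IHn]; first by rewrite big_ord1 big_ord0 mulr1.
rewrite [RHS]big_ord_recr /= -IHn mulrDr [LHS]big_ord_recl mul0r add0r.
under eq_bigr => j _ do rewrite /= natrD mulrDl.
rewrite big_split /=; congr (_ + _).
  by rewrite mulr_suml; apply: eq_bigr => j _; rewrite -mulrA -exprSr.
rewrite big_ord_recr /= stirling1_gt // muln0 mul0r addr0.
have stirling1n0M : (stirling1 n 0)%:R * n%:R = 0 :> R.
  by case: (n) => [|k]; rewrite ?mulr0 ?mul0r.
rewrite [in RHS]big_ord_recl mulrDl mulr1 stirling1n0M add0r.
rewrite mulr_suml; apply: eq_bigr => j _.
by rewrite natrM -mulrA mulrC.
Qed.

Lemma prod_rising_ffact p n : (\prod_(i < n) (p.+1 + i) = (p + n) ^_ n)%N.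
Proof.
elim: n => [|n IHn]; first by rewrite big_ord0.
by rewrite big_ord_recr /= IHn addnS ffactSS addSn mulnC.
Qed.

Lemma sum_stirling1_ffact (R : comPzSemiRingType) n p :
  \sum_(j < n.+1) (stirling1 n j)%:R * p.+1%:R ^+ j = ((p + n) ^_ n)%:R :> R.
Proof.
rewrite sum_stirling1_rising -prod_rising_ffact natr_prod.
by apply: eq_bigr => i _; rewrite natrD.
Qed.

Fixpoint stirling2 (n m : nat) : nat :=
  match n, m with
  | 0, 0 => 1
  | 0, _.+1 => 0
  | _.+1, 0 => 0
  | n'.+1, m'.+1 => stirling2 n' m' + m * stirling2 n' m
  end%N.

Lemma stirling2SS n m :
  stirling2 n.+1 m.+1 = (stirling2 n m + m.+1 * stirling2 n m.+1)%N.
Proof. by []. Qed.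

Definition stirling2_gf (R : comNzRingType) m : {fps R} :=
  Fps (fun n => (stirling2 n.+1 m.+1)%:R).

Section Stirling2Gf.
Variable R : comNzRingType.
Local Notation X := (fpsX R).

Lemma fps_coef_stirling2_gf m n :
  stirling2_gf R m n = (stirling2 n.+1 m.+1)%:R.
Proof. by []. Qed.

Lemma stirling2_gf0M : stirling2_gf R 0 * (1 - X) = 1.
Proof.
apply/fpsP => -[|n]; rewrite mulrBr mulr1 fps_coefB mulrC.
  by rewrite fps_coef0M mul0r subr0.
by rewrite fps_coefXM /= mul1n subrr.
Qed.

Lemma stirling2_gfSM m :
  stirling2_gf R m.+1 * (1 - m.+2%:R * X) = X * stirling2_gf R m.
Proof.
apply/fpsP => -[|n]; rewrite mulrBr mulr1 mulrC -mulrA fps_coefB mulr_natl.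
  by rewrite fps_coefMn !fps_coef0M !mul0r mul0rn subr0 /= muln0.
rewrite fps_coefMn !fps_coefXM !fps_coef_stirling2_gf stirling2SS natrD.
by rewrite mulnC -mulrnA addrK.
Qed.

Lemma stirling2_gfM m :
  stirling2_gf R m * \prod_(1 <= i < m.+2) (1 - i%:R * X) = X ^+ m.
Proof.
elim: m => [|m IHm]; first by rewrite big_nat1 mul1r stirling2_gf0M.
rewrite big_nat_recr //= [_ * (1 - _)]mulrC mulrA stirling2_gfSM.
by rewrite -mulrA IHm exprS.
Qed.

End Stirling2Gf.

Section Qfrac.
Variable R : comUnitRingType.

Lemma oneBnatX_unit i : 1 - i%:R * fpsX R \is a GRing.unit.
Proof. by rewrite fps_oneB_unit // fps_coef0M mulr0. Qed.

Lemma Qfrac_stirling2 j : Qfrac j (fpsX R) = stirling2_gf R j.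
Proof.
rewrite /Qfrac -stirling2_gfM mulrK //.
by apply: rpred_prod => i _; apply: oneBnatX_unit.
Qed.

End Qfrac.

Lemma rmorph_Qfrac (A B : comUnitRingType) (phi : {rmorphism A -> B}) j
    (X : A) :
  (forall i, 1 - i%:R * X \is a GRing.unit) ->
  phi (Qfrac j X) = Qfrac j (phi X).
Proof.
move=> XU; rewrite /Qfrac rmorph_div; last by apply: rpred_prod => i _.
rewrite rmorphXn rmorph_prod; congr (_ / _); apply: eq_bigr => i _.
by rewrite rmorphB rmorph1 rmorphM rmorph_nat.
Qed.

Section ExpStirling2.
Variable R : comUnitRingType.
Hypothesis factU : fact_units R.
Local Notation E := (fps_expCX (1 : R)).

Lemma fps_deriv_expMexpm1X j : fps_deriv (E * (E - 1) ^+ j) =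
  E * (E - 1) ^+ j *+ j.+1 + E * (E - 1) ^+ j.-1 *+ j.
Proof.
have dE : fps_deriv E = E by rewrite fps_deriv_expCX // rmorph1 mul1r.
have dE1 : fps_deriv (E - 1) = E.
  by rewrite fps_derivB dE -(rmorph1 (@fpsC R)) fps_derivC subr0.
rewrite fps_derivM fps_derivXn dE dE1.
case: j => [|j]; first by rewrite !mulr0n mulr0 !addr0.
by rewrite /= exprS !mulrS; ring.
Qed.

Lemma fps_coef_expMexpm1X j n :
  (E * (E - 1) ^+ j) n * n`!%:R = (j`! * stirling2 n.+1 j.+1)%:R.
Proof.
elim: n j => [|n IHn] j.
  rewrite fps_coef0M mulr1; case: j => [|j].
    by rewrite fps_expCX_coef0 mulr1.
  rewrite exprS fps_coef0M fps_coefB fps_expCX_coef0 subrr mul0r mulr0 /=.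
  by rewrite !muln0.
rewrite fps_coefS_deriv fps_deriv_expMexpm1X fps_coefD !fps_coefMn mulrDl.
rewrite !mulrnAl !IHn -!mulrnA -natrD; congr _%:R.
rewrite (stirling2SS n.+1); case: j => [|j] /=; first by rewrite add0n; lia.
by rewrite factS; lia.
Qed.

Lemma fps_borel_Qfrac j :
  fps_borel (Qfrac j (fpsX R) *+ j`!) = E * (E - 1) ^+ j.
Proof.
apply/fpsP => n; rewrite Qfrac_stirling2 fps_coef_borel fps_coefMn.
by rewrite -mulrnA mulnC -fps_coef_expMexpm1X mulrK.
Qed.

End ExpStirling2.

Local Notation fps_inx := (fps_map (@fpsC _)).
Local Notation fps_iny := (@fpsC {fps _}).
Local Notation expx := (fps_inx (fps_expCX 1)).
Local Notation expy := (fps_iny (fps_expCX 1)).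

Section Bivariate.
Variable R : comUnitRingType.
Implicit Types (f g u : {fps {fps R}}) (a b : R).

Lemma varx_inx : varx = fps_inx (fpsX R).
Proof. by apply/fpsP => n; rewrite fps_coef_map rmorph_nat. Qed.

Lemma fps_inx_Qfrac j : fps_inx (Qfrac j (fpsX R)) = Qfrac j varx.
Proof. by rewrite varx_inx rmorph_Qfrac //; apply: oneBnatX_unit. Qed.

Lemma fps_iny_Qfrac j : fps_iny (Qfrac j (fpsX R)) = Qfrac j vary.
Proof. by rewrite rmorph_Qfrac //; apply: oneBnatX_unit. Qed.

Lemma fps_coef_inxMiny (p q : {fps R}) l m :
  (fps_inx p * fps_iny q) l m = p l * q m.
Proof. by rewrite mulrC fps_coefCM mulrC fps_coefCM. Qed.

Lemma fps2_coefM f g l m : (f * g) l m =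
  \sum_(i < l.+1) \sum_(k < m.+1) f i k * g (l - i)%N (m - k)%N.
Proof. by rewrite fps_coefM fps_coef_sum. Qed.

Lemma fps2_coef00M f g : (f * g) 0%N 0%N = f 0%N 0%N * g 0%N 0%N.
Proof. by rewrite !fps_coef0M. Qed.

Lemma fps2_oneB_unit f : f 0%N 0%N = 0 -> 1 - f \is a GRing.unit.
Proof. by move=> f0; rewrite fps_unitE fps_oneB_unit. Qed.

Definition fps2_order_ge k f := forall l m, (l + m < k)%N -> f l m = 0.

Lemma fps2_order_geM k1 k2 f g :
  fps2_order_ge k1 f -> fps2_order_ge k2 g -> fps2_order_ge (k1 + k2) (f * g).
Proof.
move=> f_ge g_ge l m lt_lm; rewrite fps2_coefM.
rewrite big1 // => i _; rewrite big1 // => k _.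
case: (ltnP (i + k) k1) => [/f_ge->|le_k1]; first by rewrite mul0r.
by rewrite g_ge ?mulr0 //; have := ltn_ord i; have := ltn_ord k; lia.
Qed.

Lemma fps2_order_geXn u k : u 0%N 0%N = 0 -> fps2_order_ge k (u ^+ k).
Proof.
move=> u0; elim: k => [|k IHk] //; rewrite exprS.
by apply: (@fps2_order_geM 1) => // -[|l] [|m].
Qed.

Lemma fps2_coef_exp_linear a b l m :
  fps2_exp (fpsC (fpsC a) * varx + fpsC (fpsC b) * vary) l m =
  (l + m)`!%:R^-1 * (a ^+ l * b ^+ m *+ 'C(l + m, l)).
Proof.
have coefXn i : ((fpsC (fpsC a) * varx + fpsC (fpsC b) * vary) ^+ i) l m =
    a ^+ l * b ^+ m *+ 'C(i, l) *+ (i == l + m)%N.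
  rewrite addrC -rmorphM fps_coefXn_affine fps_coefMn mulrC -rmorphXn.
  rewrite fps_coefCM fps_coefXn_linear mulrnAr -!mulrnA mulnC.
  case: (leqP l i) => [le_li|/bin_small->]; last by rewrite !mul0n.
  rewrite (_ : (i - l == m)%N = (i == l + m)%N); last by lia.
  by case: eqP => [->|_]; rewrite ?addKn // !muln0.
rewrite /= big_ord_recr /= coefXn eqxx big1 ?add0r // => i _.
by rewrite coefXn ltn_eqF // mulr0.
Qed.

Lemma fps2_exp_linear a b : fact_units R ->
  fps2_exp (fpsC (fpsC a) * varx + fpsC (fpsC b) * vary) =
  fps_inx (fps_expCX a) * fps_iny (fps_expCX b).
Proof.
move=> factU; apply/fpsP => l; apply/fpsP => m.
rewrite fps2_coef_exp_linear fps_coef_inxMiny !fps_coef_expCX mulrC mulrnAl.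
by rewrite -mulrnAr invr_fact_bin ?leq_addr // addKn mulrACA.
Qed.

Lemma fps2_exp_varx : fact_units R -> fps2_exp varx = expx :> {fps {fps R}}.
Proof.
move=> factU; have := fps2_exp_linear 1 0 factU.
by rewrite !rmorph0 !rmorph1 mul0r addr0 mul1r fps_expCX0 rmorph1 mulr1.
Qed.

Lemma fps2_exp_vary : fact_units R -> fps2_exp vary = expy :> {fps {fps R}}.
Proof.
move=> factU; have := fps2_exp_linear 0 1 factU.
by rewrite !rmorph0 !rmorph1 mul0r add0r mul1r fps_expCX0 rmorph1 mul1r.
Qed.

Lemma fps2_exp_varxDvary : fact_units R ->
  fps2_exp (varx + vary) = expx * expy :> {fps {fps R}}.
Proof.
by move=> factU; have := fps2_exp_linear 1 1 factU; rewrite !rmorph1 !mul1r.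
Qed.

Lemma fps2_is_sum_unique F S T :
  @fps2_is_sum R F S -> fps2_is_sum F T -> S = T.
Proof.
move=> FS FT; apply/fpsP => l; apply/fpsP => m.
have [[N FN] [N' FN']] := (FS l m, FT l m).
by rewrite -(FN (maxn N N')) ?leq_maxl // FN' ?leq_maxr.
Qed.

Lemma eq_fps2_is_sum F G S :
  F =1 G -> @fps2_is_sum R F S -> fps2_is_sum G S.
Proof.
move=> eqFG FS l m; have [N FN] := FS l m; exists N => M le_NM.
by rewrite -(FN M le_NM); congr (fps_coef (fps_coef _ l) m); apply: eq_bigr.
Qed.

Lemma fps2_is_sumMl c F S :
  @fps2_is_sum R F S -> fps2_is_sum (fun j => c * F j) (c * S).
Proof.
move=> FS l m.
have [N FN] := fin_all_exists (fun ik : 'I_l.+1 * 'I_m.+1 =>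
  FS (l - ik.1)%N (m - ik.2)%N).
exists (\max_ik N ik) => M le_NM; rewrite -mulr_sumr !fps2_coefM.
apply: eq_bigr => i _; apply: eq_bigr => k _; congr (_ * _).
by apply: (FN (i, k)); apply: leq_trans (leq_bigmax _) le_NM.
Qed.

End Bivariate.

Lemma oneBM_sum_bin (A : comNzRingType) (u : A) n M :
  (1 - u) * \sum_(j < M) 'C(j + n.+1, n.+1)%:R * u ^+ j =
  \sum_(j < M) 'C(j + n, n)%:R * u ^+ j - 'C(M + n, n.+1)%:R * u ^+ M.
Proof.
elim: M => [|M IHM].
  by rewrite !big_ord0 mulr0 add0n bin_small // mul0r subrr.
rewrite !big_ord_recr /= mulrDr {}IHM addnS addSn binS natrD exprS.
by ring.
Qed.

Lemma binomial_series_modXn (A : comUnitRingType) (u : A) n M :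
  1 - u \is a GRing.unit -> exists r,
  \sum_(j < M) 'C(j + n, n)%:R * u ^+ j = (1 - u) ^- n.+1 + r * u ^+ M.
Proof.
move=> uU; elim: n => [|n [r IHn]].
  exists (- (1 - u)^-1); apply: (mulrI uU).
  under eq_bigr => j _ do rewrite bin0 mul1r.
  transitivity (1 - u ^+ M); first by rewrite -opprB mulNr -subrX1 opprB.
  by rewrite mulrDr mulrA mulrN divrr // mulN1r.
exists ((1 - u)^-1 * (r - 'C(M + n, n.+1)%:R)); apply: (mulrI uU).
rewrite oneBM_sum_bin IHn [in RHS]exprSr invrM ?unitrX //.
by rewrite mulrDr -mulrA !mulVKr // mulrBl addrA.
Qed.

Section BivariateSums.
Variable R : comUnitRingType.
Implicit Types (f u : {fps {fps R}}) (p q : {fps R}).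

Lemma fps2_is_sum_binomial u n : u 0%N 0%N = 0 ->
  fps2_is_sum (fun j => 'C(j + n, n)%:R * u ^+ j) ((1 - u) ^- n.+1).
Proof.
move=> u0 l m; exists (l + m).+1 => M lt_lmM.
have [r ->] := binomial_series_modXn n M (fps2_oneB_unit u0).
rewrite !fps_coefD (@fps2_order_geM _ 0 M) ?addr0 //.
exact: fps2_order_geXn.
Qed.

Definition fps2_borel f : {fps {fps R}} :=
  Fps (fun l => Fps (fun m => f l m / l`!%:R / m`!%:R)).

Lemma fps2_coef_borel f l m : fps2_borel f l m = f l m / l`!%:R / m`!%:R.
Proof. by []. Qed.

Lemma fps2_borel_inxMiny p q :
  fps2_borel (fps_inx p * fps_iny q) =
  fps_inx (fps_borel p) * fps_iny (fps_borel q).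
Proof.
apply/fpsP => l; apply/fpsP => m.
by rewrite fps2_coef_borel !fps_coef_inxMiny !fps_coef_borel -mulrA mulrACA.
Qed.

Lemma fps2_borelMn f k : fps2_borel (f *+ k) = fps2_borel f *+ k.
Proof.
apply/fpsP => l; apply/fpsP => m.
by rewrite !(fps2_coef_borel, fps_coefMn) !mulrnAl.
Qed.

Lemma fps2_is_sum_borel F S : fact_units R ->
  fps2_is_sum (fun j => fps2_borel (F j)) (fps2_borel S) -> fps2_is_sum F S.
Proof.
move=> factU FS l m; have [N FN] := FS l m; exists N => M /FN.
rewrite fps2_coef_borel => /(congr1 (fun c => c * m`!%:R * l`!%:R)).
rewrite !divrK // => <-; rewrite !fps_coef_sum !mulr_suml.
by apply: eq_bigr => j _; rewrite fps2_coef_borel !divrK.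
Qed.

Lemma fps2_borel_Qfrac j n : fact_units R ->
  fps2_borel (j`!%:R * (j + n)`!%:R * Qfrac j varx * Qfrac j vary) =
  n`!%:R * (expx * expy) * ('C(j + n, n)%:R * ((expx - 1) * (expy - 1)) ^+ j).
Proof.
move=> factU; set Q := Qfrac j (fpsX R) *+ j`!.
transitivity (fps2_borel (fps_inx Q * fps_iny Q *+ ('C(j + n, n) * n`!))).
  congr fps2_borel; rewrite -(bin_fact (leq_addl j n)) addnK.
  rewrite !rmorphMn /= fps_inx_Qfrac fps_iny_Qfrac.
  rewrite -[Qfrac j varx *+ _]mulr_natl -[Qfrac j vary *+ _]mulr_natl.
  by rewrite -[RHS]mulr_natl !natrM; ring.
rewrite fps2_borelMn fps2_borel_inxMiny !fps_borel_Qfrac //.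
rewrite !rmorphM !rmorphXn !rmorphB !rmorph1 exprMn -[LHS]mulr_natl natrM /=.
by ring.
Qed.

Lemma exp_binomial_termE n (p : nat) : fact_units R ->
  n`!%:R * expx / expy ^+ n * ('C(p + n, n)%:R * (expx * (1 - expy^-1)) ^+ p) =
  fps_inx (fps_expCX p.+1%:R) *
    fps_iny (fps_expCX (- n%:R) * (1 - fps_expCX (-1)) ^+ p) *+ (p + n) ^_ n
  :> {fps {fps R}}.
Proof.
move=> factU; rewrite -mulNrn !fps_expCXMn // fps_expCXN //.
rewrite rmorphM !rmorphXn rmorphB rmorph1 rmorphV ?fps_expCX_unit // exprVn.
rewrite -[RHS]mulr_natl -bin_ffact natrM exprMn exprS /=.
by ring.
Qed.

Lemma expy_unit : (expy : {fps {fps R}}) \is a GRing.unit.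
Proof. by rewrite rmorph_unit ?fps_expCX_unit. Qed.

Lemma expy_coef00 : (expy : {fps {fps R}}) 0%N 0%N = 1.
Proof. exact: fps_expCX_coef0. Qed.

Lemma expm1M_coef00 :
  ((expx - 1) * (expy - 1) : {fps {fps R}}) 0%N 0%N = 0.
Proof. by rewrite fps2_coef00M !fps_coefB expy_coef00 subrr mulr0. Qed.

Lemma expxM_oneBexpyV_coef00 :
  (expx * (1 - expy^-1) : {fps {fps R}}) 0%N 0%N = 0.
Proof.
rewrite fps2_coef00M !fps_coefB (fps_coef0V expy_unit).
by rewrite fps_coef0V ?fps_expCX_unit // expy_coef00 invr1 subrr mulr0.
Qed.

End BivariateSums.

Lemma symmetric_closed_form (A : comUnitRingType) (x y : A) n :
  y \is a GRing.unit -> 1 - x * (1 - y^-1) \is a GRing.unit ->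
  x / y ^+ n / (1 - x * (1 - y^-1)) ^+ n.+1 =
  x * y / (1 - (x - 1) * (y - 1)) ^+ n.+1.
Proof.
move=> yU denU.
have -> : 1 - (x - 1) * (y - 1) = y * (1 - x * (1 - y^-1)).
  rewrite !(mulrBr, mulrBl) !(mulr1, mul1r) [y * (x / y)]mulrCA divrr //.
  by ring.
have -> : y ^- n = y / y ^+ n.+1 by rewrite exprSr invrM ?unitrX // mulVKr.
by rewrite exprMn [in RHS]invrM ?unitrX // [_^-1 * _]mulrC !mulrA.
Qed.

Lemma fact_units_rat : fact_units rat.
Proof. exact: fact_units_numField. Qed.

Definition succ_powers (R : comNzRingType) k : {fps R} :=
  Fps (fun p => p.+1%:R ^+ k).

Lemma fps_shift_polylogN (R : comUnitRingType) k :
  fps_shift (polylog R (- k%:Z)) = succ_powers R k.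
Proof. by apply/fpsP => p; rewrite /= opprK -exprnP. Qed.

Lemma fps_map_succ_powers (R S : comNzRingType) (phi : {rmorphism R -> S}) k :
  fps_map phi (succ_powers R k) = succ_powers S k.
Proof. by apply/fpsP => p; rewrite /= rmorphXn rmorph_nat. Qed.

Lemma fps_oneBexpCX_coef0 (R : comUnitRingType) (a : R) :
  (1 - fps_expCX a) 0%N = 0.
Proof. by rewrite fps_coefB fps_expCX_coef0 subrr. Qed.

(* [e^(-at) Li_(-k)(1 - e^(-t)) / (1 - e^(-t))]; the quotient by [1 - e^(-t)]
   becomes the substitution of [1 - e^(-t)] into [Li_(-k)(z) / z]. *)
Definition polyBernoulliN_gf (R : comUnitRingType) k (a : R) : {fps R} :=
  fps_expCX (- a) * fps_comp (succ_powers R k) (1 - fps_expCX (-1)).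

Lemma polyBernoulli_gfN k :
  polyBernoulli_gf (- k%:Z) = polyBernoulliN_gf k 'X.
Proof.
have one_sub_expNE : one_sub_expN = 1 - fps_expCX (-1).
  by rewrite /fps_expCX rmorphN1 mulN1r.
have coef1U : (1 - fps_expCX (-1)) 1%N \is a @GRing.unit {poly rat}.
  by rewrite fps_coefB fps_coef_expCX invr1 mulr1 sub0r opprK unitr1.
rewrite /polyBernoulli_gf one_sub_expNE -mulNr -rmorphN.
by rewrite (fps_quo_comp _ (fps_oneBexpCX_coef0 _) coef1U) ?fps_shift_polylogN.
Qed.

Lemma fps_map_polyBernoulliN_gf (R S : comUnitRingType)
    (phi : {rmorphism R -> S}) k a : fact_units R ->
  fps_map phi (polyBernoulliN_gf k a) = polyBernoulliN_gf k (phi a).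
Proof.
move=> factU; rewrite rmorphM /= fps_map_comp rmorphB rmorph1 /=.
by rewrite fps_map_succ_powers !(fps_map_expCX _ _ factU) !rmorphN rmorph1.
Qed.

Lemma horner_polyBernoulliN m k (c : rat) :
  (polyBernoulli m (- k%:Z)).[c] = m`!%:R * polyBernoulliN_gf k c m.
Proof.
have factU := fact_units_rmorph (@polyC rat) fact_units_rat.
rewrite -[LHS]/(horner_eval c _) rmorphM rmorph_nat polyBernoulli_gfN.
rewrite -(fps_coef_map (horner_eval c)) (fps_map_polyBernoulliN_gf _ _ _ factU).
by congr (_ * fps_coef (polyBernoulliN_gf k _) m); apply: hornerX.
Qed.

Definition scrB_gf n : {fps {fps rat}} :=
  Fps (fun l => Fps (fun m => scrB m l n)).

Lemma fps_borel_scrB_gf n l : fps_borel (scrB_gf n l) =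
  fps_expCX (- n%:R) *
  fps_comp (Fps (fun p => ((p + n) ^_ n)%:R * p.+1%:R ^+ l))
    (1 - fps_expCX (-1)).
Proof.
have -> : Fps (fun p => ((p + n) ^_ n)%:R * p.+1%:R ^+ l) =
    \sum_(j < n.+1) fpsC (stirling1 n j)%:R * succ_powers rat (l + j).
  apply/fpsP => p; rewrite fps_coef_sum [LHS]/= -sum_stirling1_ffact mulr_suml.
  by apply: eq_bigr => j _; rewrite fps_coefCM /= addnC exprD mulrA.
apply/fpsP => m; rewrite fps_coef_borel fps_comp_suml mulr_sumr fps_coef_sum.
rewrite mulr_suml; apply: eq_bigr => j _.
rewrite -opprD -PoszD horner_polyBernoulliN fps_compCM.
rewrite [in RHS]mulrCA fps_coefCM -mulrA [_ * _ / _]mulrAC divrr ?mul1r //.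
exact: fact_units_rat.
Qed.

Lemma fps2_is_sum_borel_scrB_gf n :
  fps2_is_sum (fun p => n`!%:R * expx / expy ^+ n *
                 ('C(p + n, n)%:R * (expx * (1 - expy^-1)) ^+ p))
    (fps2_borel (scrB_gf n)).
Proof.
move=> l m; exists m.+1 => M lt_mM.
rewrite fps2_coef_borel [RHS]mulrAC -fps_coef_borel fps_borel_scrB_gf.
rewrite (fps_coefM_comp _ _ (fps_oneBexpCX_coef0 _) lt_mM) mulr_suml.
rewrite !fps_coef_sum; apply: eq_bigr => p _.
rewrite exp_binomial_termE; last exact: fact_units_rat.
rewrite !fps_coefMn fps_coef_inxMiny fps_coef_expCX -[LHS]mulr_natl.
by rewrite !mulrA [RHS]mulrAC.
Qed.

Lemma fps2_borel_scrB_gf n : fps2_borel (scrB_gf n) =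
  n`!%:R * (expx * expy) / (1 - (expx - 1) * (expy - 1)) ^+ n.+1.
Proof.
have u0 := expxM_oneBexpyV_coef00 rat.
have denU := fps2_oneB_unit u0.
rewrite -mulrA -(symmetric_closed_form _ (expy_unit _) denU) !mulrA.
apply: fps2_is_sum_unique (fps2_is_sum_borel_scrB_gf n) _.
exact: fps2_is_sumMl (fps2_is_sum_binomial n u0).
Qed.

Theorem theorem2p1 (n : nat) :
  (Fps (fun l => Fps (fun m => scrB m l n / l`!%:R / m`!%:R))
     = n`!%:R * fps2_exp (varx + vary)
       / (fps2_exp varx + fps2_exp vary - fps2_exp (varx + vary)) ^+ n.+1
     :> {fps {fps rat}})
  /\
  fps2_is_sum
    (fun j => j`!%:R * (j + n)`!%:R * Qfrac j varx * Qfrac j vary)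
    (Fps (fun l => Fps (fun m => scrB m l n)) : {fps {fps rat}}).
Proof.
have factU := fact_units_rat; split.
  rewrite -[LHS]/(fps2_borel (scrB_gf n)) fps2_borel_scrB_gf.
  rewrite (fps2_exp_varx factU) (fps2_exp_vary factU).
  by rewrite (fps2_exp_varxDvary factU); congr (_ / _ ^+ _); ring.
apply: (@fps2_is_sum_borel _ _ (scrB_gf n) factU); rewrite fps2_borel_scrB_gf.
apply: eq_fps2_is_sum (fps2_is_sumMl _ (fps2_is_sum_binomial n _)) => [j|].
  exact/esym/fps2_borel_Qfrac.
exact: expm1M_coef00.
Qed.
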